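(* Let $L$ and $f$ be as in the context and assume (F-1$'$), (F-2$'$), (F-3), (F-4a) and (L-1) hold, and that the function $G$ of (F-4a) satisfies $G(u)<0$ for all $u>0$. Then the stationary equation (1.3) has no solution other than $W\equiv0$. In particular this conclusion holds whenever $f(x,\cdot)$ is concave for each $x$, $F(u)<0$ for all $u>0$, and (F-2$'$), (F-3), (L-1) hold.
   Context: Let $L=\sum_{i,j=1}^n a_{ij}(x)\frac{\partial^2}{\partial x_i\partial x_j}+\sum_{i=1}^n b_i(x)\frac{\partial}{\partial x_i}$ with $a_{ij},b_i\in C^{\alpha}(\mathbb{R}^n)$ and $\sum_{i,j}a_{ij}(x)\nu_i\nu_j>0$ for all $x\in\mathbb{R}^n$, $\nu\in\mathbb{R}^n\setminus\{0\}$. Let $f:\mathbb{R}^n\times[0,\infty)\to\mathbb{R}$ be locally Lipschitz in $x$ and in $u$. The stationary equation (1.3): $LW+f(x,W)=0$ in $\mathbb{R}^n$, $W\ge0$, $W\in C^2(\mathbb{R}^n)$. Let $F(u)=\sup_{x\in\mathbb{R}^n}f(x,u)$ and let $\log^{(i)}$ be the $i$-th iterate of $\log$, with $\prod_{i=1}^0\log^{(i)}u=1$. (F-1$'$): $\sup_{u>0}F(u)<\infty$. (F-2$'$): there exist an integer $m\ge0$ and $\epsilon>0$ with $\lim_{u\to\infty}\frac{F(u)}{u(\prod_{i=1}^m\log^{(i)}u)^2(\log^{(m+1)}u)^{2+\epsilon}}=-\infty$. (F-3): $f(x,0)=0$ for all $x$, and $F$ is locally Lipschitz. (F-4a): the function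 $G(u)=\sup_{x\in\mathbb{R}^n}\sup_{v\ge u}\big(f(x,v)-f(x,v-u)\big)$ is locally Lipschitz, is negative for all sufficiently large $u$, and satisfies $\int^\infty\frac{du}{-G(u)}<\infty$. (L-1): there is $C>0$ with $\sum_{i,j}a_{ij}(x)\nu_i\nu_j\le C|\nu|^2(1+|x|^2)$ for all $x,\nu$ and $|b(x)|\le C(1+|x|)$, where $b=(b_1,\dots,b_n)$. *)

(* Defs.v *)
From HB Require Import structures.
From mathcomp Require Import all_boot all_order all_algebra.
From mathcomp Require Import all_classical all_reals all_analysis.
Set Implicit Arguments. Unset Strict Implicit. Unset Printing Implicit Defensive.
Import Order.TTheory GRing.Theory Num.Theory.
Import numFieldNormedType.Exports.
Local Open Scope classical_set_scope.
Local Open Scope ring_scope.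

Section Defs.
Variables (R : realType) (n : nat).
Local Notation V := 'rV[R]_n.

Definition enorm (x : V) : R := Num.sqrt (\sum_(i < n) x ord0 i ^+ 2).

Definition pd (i : 'I_n) (g : V -> R) : V -> R :=
  fun x => derive g x (delta_mx ord0 i).

Definition C2 (W : V -> R) : Prop :=
  (forall x, differentiable W x) /\
  (forall i x, differentiable (pd i W) x) /\
  (forall i j, continuous (pd j (pd i W))).

Definition loc_holder (alpha : R) (g : V -> R) : Prop :=
  forall r : R, 0 < r -> exists K : R, forall x y : V,
    enorm x <= r -> enorm y <= r -> `|g x - g y| <= K * (enorm (x - y)) `^ alpha.

Definition loc_lip_xu (f : V -> R -> R) : Prop :=
  forall r : R, 0 < r -> exists K : R, forall (x y : V) (u v : R),
    enorm x <= r -> enorm y <= r -> 0 <= u <= r -> 0 <= v <= r ->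
    `|f x u - f y v| <= K * (enorm (x - y) + `|u - v|).

Definition loc_lip0 (g : R -> R) : Prop :=
  forall r : R, 0 < r -> exists K : R, forall u v : R,
    0 <= u <= r -> 0 <= v <= r -> `|g u - g v| <= K * `|u - v|.

Definition Fsup (f : V -> R -> R) (u : R) : \bar R :=
  ereal_sup [set (f x u)%:E | x in [set: V]].

Definition Gsup (f : V -> R -> R) (u : R) : \bar R :=
  ereal_sup [set (f x v - f x (v - u))%:E | x in [set: V] & v in [set v | u <= v]].

Definition Lop (a : 'I_n -> 'I_n -> V -> R) (b : 'I_n -> V -> R) (W : V -> R) (x : V) : R :=
  \sum_(i < n) \sum_(j < n) a i j x * pd j (pd i W) x + \sum_(i < n) b i x * pd i W x.

Definition stationary_sol a b (f : V -> R -> R) (W : V -> R) : Prop :=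
  C2 W /\ (forall x, 0 <= W x) /\ (forall x, Lop a b W x + f x (W x) = 0).

Definition elliptic (a : 'I_n -> 'I_n -> V -> R) : Prop :=
  forall x (nu : V), nu != 0 -> 0 < \sum_(i < n) \sum_(j < n) a i j x * nu ord0 i * nu ord0 j.

Definition L1 (a : 'I_n -> 'I_n -> V -> R) (b : 'I_n -> V -> R) : Prop :=
  exists C : R, 0 < C /\
    (forall x (nu : V), \sum_(i < n) \sum_(j < n) a i j x * nu ord0 i * nu ord0 j
                        <= C * enorm nu ^+ 2 * (1 + enorm x ^+ 2)) /\
    (forall x, enorm (\row_(i < n) b i x) <= C * (1 + enorm x)).

Definition F1' (f : V -> R -> R) : Prop :=
  exists M : R, forall u, 0 < u -> (Fsup f u <= M%:E)%E.

Definition growth (m : nat) (eps : R) (u : R) : R :=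
  u * (\prod_(1 <= i < m.+1) iter i (@ln R) u) ^+ 2 * (iter m.+1 (@ln R) u) `^ (2 + eps).

Definition F2' (f : V -> R -> R) : Prop :=
  exists (m : nat) (eps : R), 0 < eps /\
    (fun u => fine (Fsup f u) / growth m eps u) @ +oo --> -oo.

Definition F3 (f : V -> R -> R) : Prop :=
  (forall x, f x 0 = 0) /\ loc_lip0 (fun u => fine (Fsup f u)).

Definition F4a (f : V -> R -> R) : Prop :=
  loc_lip0 (fun u => fine (Gsup f u)) /\
  (\forall u \near +oo, (Gsup f u < 0)%E) /\
  exists c : R, 0 < c /\ (forall u, c <= u -> (Gsup f u < 0)%E) /\
    (\int[lebesgue_measure]_(u in `[c, +oo[%classic) ((- fine (Gsup f u))^-1)%:E < +oo)%E.

End Defs.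

(* Main.v *)
Require Import Defs.
From HB Require Import structures.
From mathcomp Require Import all_boot all_order all_algebra.
From mathcomp Require Import all_classical all_reals all_analysis.
From mathcomp Require Import ring lra.
Set Implicit Arguments. Unset Strict Implicit. Unset Printing Implicit Defensive.
Import Order.TTheory GRing.Theory Num.Theory.
Import numFieldNormedType.Exports.
Local Open Scope classical_set_scope.
Local Open Scope ring_scope.

(** If [F < 0] on the positive reals, a solution satisfies [L W >= - F (W) > 0] wherever [W > 0].
    Let [Psi' = 1 / g > 0] with [Psi (W)] bounded above, and consider a maximum point of
    [Psi (W) - delta ln (1 + |x|^2)].  By (L-1), [L] of the penalty and the [a]-length of its
    gradient are bounded, so the first and second order conditions there give
    [L W <= O (delta) g + O (delta^2) g g'].  If [g] and [g g'] are [O (L W)] this is absurd for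
    small [delta], unless [W] does not exceed the level above which [Psi] is considered.  A first
    application, with [g ^ 2 / u] equal to the growth of (F-2'), shows that [W] is bounded; a
    second one, with [Psi] the identity, shows that [W] lies below every positive level, since
    [- F] is bounded away from [0] on compact intervals of positive reals. *)

(** * Positive definite forms as sums of squares *)

(* Gaussian elimination of one variable at a time: subtracting the square that
   involves the first coordinate leaves the (positive definite) Schur complement. *)
Lemma posdef_sum_rank1 (R : rcfType) (n : nat) (A : 'M[R]_n) :
  A^T = A -> (forall v : 'rV_n, v != 0 -> 0 < (v *m A *m v^T) ord0 ord0) ->
  exists s : seq 'rV[R]_n, A = \sum_(v <- s) v^T *m v.
Proof.
elim: n A => [|n IH] A symA posA.
  by exists [::]; rewrite big_nil; apply/matrixP => -[].
rewrite -[n.+1]/(1 + n)%N in A symA posA *.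
pose alpha := A ord0 ord0.
have alpha_gt0 : 0 < alpha.
  have e0 : (delta_mx ord0 ord0 : 'rV[R]_(1 + n)) != 0.
    by apply/eqP => /matrixP /(_ ord0 ord0); rewrite !mxE !eqxx => /eqP; rewrite oner_eq0.
  have := posA _ e0.
  by rewrite trmx_delta -rowE -colE !mxE.
pose w : 'rV[R]_(1 + n) := row ord0 A.
have wE j : w ord0 j = A ord0 j by rewrite mxE.
have A0C i : A i ord0 = A ord0 i by rewrite -{1}symA mxE.
pose A' := A - alpha^-1 *: (w^T *m w).
have A'E i j : A' i j = A i j - alpha^-1 * (A ord0 i * A ord0 j).
  by rewrite !mxE big_ord1 !mxE.
have A'0 j : A' ord0 j = 0.
  by rewrite A'E -/alpha mulrA mulVf ?gt_eqF // mul1r subrr.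
have A'0r i : A' i ord0 = 0.
  by rewrite A'E A0C -/alpha mulrCA mulVf ?gt_eqF // mulr1 subrr.
pose B := drsubmx A'.
have A'B : A' = block_mx 0 0 0 B.
  rewrite /B; move: A'0 A'0r; move: (A') => M M0 M0r.
  rewrite -[LHS]submxK; congr block_mx; apply/matrixP => i j; rewrite !mxE //.
  - by rewrite ord1 (_ : lshift n 0 = ord0) ?M0 //; apply: val_inj.
  - by rewrite ord1 (_ : lshift n 0 = ord0) ?M0 //; apply: val_inj.
  - by rewrite (ord1 j) (_ : lshift n 0 = ord0) ?M0r //; apply: val_inj.
have symA' : A'^T = A'.
  by rewrite /A' linearB /= linearZ /= trmx_mul trmxK symA.
have symB : B^T = B.
  by rewrite /B -[in RHS]symA' trmx_drsub.
have posB (y : 'rV_n) : y != 0 -> 0 < (y *m B *m y^T) ord0 ord0.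
  (* This [c] completes the square: it makes [z] orthogonal to the first row [w], so the removed
     square vanishes on [z] and the form of [A] at [z] is that of [B] at [y]. *)
  move=> y0; pose c := - (y *m (rsubmx w)^T) ord0 ord0 / alpha.
  pose z : 'rV[R]_(1 + n) := row_mx (c%:M : 'M[R]_1) y.
  have z0 : z != 0.
    by apply: contraNneq y0 => /(congr1 rsubmx); rewrite row_mxKr linear0 => ->.
  have zw : z *m w^T = 0.
    rewrite -[w]hsubmxK tr_row_mx mul_row_col; apply/matrixP => i j.
    rewrite !ord1 !mxE big_ord1 !mxE (_ : lshift n 0 = ord0); last exact: val_inj.
    rewrite -/alpha mulr1n /c mulfVK ?gt_eqF // !mxE; apply/eqP.
    by rewrite addrC subr_eq0; apply/eqP/eq_bigr => k _; rewrite !mxE.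
  have := posA _ z0.
  have -> : A = A' + alpha^-1 *: (w^T *m w) by rewrite subrK.
  rewrite mulmxDr mulmxDl -scalemxAr mulmxA zw mul0mx scaler0 mul0mx addr0.
  by rewrite A'B /z mul_row_block tr_row_mx !mulmx0 !add0r mul_row_col mul0mx add0r.
have [s Bs] := IH B symB posB.
exists ((Num.sqrt alpha)^-1 *: w :: [seq row_mx 0 y | y <- s]).
have trZ c : (c *: w)^T = c *: w^T by apply/matrixP => i j; rewrite !mxE.
rewrite big_cons big_map trZ -scalemxAl -scalemxAr scalerA -expr2 exprVn.
rewrite sqr_sqrtr ?ltW //.
have -> : \sum_(j <- s) (row_mx (0 : 'M[R]_1) j)^T *m row_mx 0 j = A'.
  rewrite A'B Bs; elim: s {Bs} => [|y s IHs].
    by rewrite !big_nil block_mx_const.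
  rewrite !big_cons IHs tr_row_mx mul_col_row trmx0 !mul0mx mulmx0.
  by rewrite add_block_mx !addr0.
by rewrite /A' addrC subrK.
Qed.

Lemma quad_formE (R : comPzRingType) (n : nat) (M : 'M[R]_n) (v : 'rV[R]_n) :
  (v *m M *m v^T) ord0 ord0 = \sum_(i < n) \sum_(j < n) M i j * v ord0 i * v ord0 j.
Proof.
rewrite mxE exchange_big; apply: eq_bigr => j _; rewrite !mxE big_distrl /=.
by apply: eq_bigr => i _; rewrite [v _ i * _]mulrC.
Qed.

(** Replacing [a] by its symmetric part changes neither its quadratic form nor its contraction with
    a symmetric [h]. With [h] a Hessian, this turns the second order part of [L] at a point into a
    finite sum of pure second derivatives along lines. *)
Lemma posdef_form_rank1 (R : rcfType) (n : nat) (a : 'I_n -> 'I_n -> R) :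
  (forall v : 'rV[R]_n, v != 0 ->
    0 < \sum_(i < n) \sum_(j < n) a i j * v ord0 i * v ord0 j) ->
  exists s : seq 'rV[R]_n, forall h : 'I_n -> 'I_n -> R, (forall i j, h i j = h j i) ->
    \sum_(i < n) \sum_(j < n) a i j * h i j =
    \sum_(v <- s) \sum_(i < n) \sum_(j < n) v ord0 i * v ord0 j * h i j.
Proof.
move=> pos; pose A : 'M[R]_n := \matrix_(i, j) ((a i j + a j i) / 2).
have symA (h : 'I_n -> 'I_n -> R) : (forall i j, h i j = h j i) ->
    \sum_(i < n) \sum_(j < n) A i j * h i j = \sum_(i < n) \sum_(j < n) a i j * h i j.
  move=> hC.
  have -> : \sum_(i < n) \sum_(j < n) A i j * h i j =
      2^-1 * (\sum_(i < n) \sum_(j < n) a i j * h i j) +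
      2^-1 * (\sum_(i < n) \sum_(j < n) a j i * h j i).
    rewrite !mulr_sumr -big_split /=; apply: eq_bigr => i _.
    rewrite !mulr_sumr -big_split /=; apply: eq_bigr => j _.
    by rewrite mxE (hC j i); field.
  by rewrite [X in _ + _ * X]exchange_big /=; field.
have [||s As] := @posdef_sum_rank1 R n A.
- by apply/matrixP => i j; rewrite !mxE addrC.
- move=> v v0; rewrite quad_formE.
  under eq_bigr do under eq_bigr do rewrite -mulrA.
  rewrite (symA (fun i j => v ord0 i * v ord0 j)); last by move=> i j; rewrite mulrC.
  by under eq_bigr do under eq_bigr do rewrite mulrA; exact: pos.
exists s => h hC; rewrite -symA // As.
transitivity (\sum_(i < n) \sum_(j < n) \sum_(v <- s) v ord0 i * v ord0 j * h i j).
  apply: eq_bigr => i _; apply: eq_bigr => j _.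
  rewrite summxE big_distrl /=; apply: eq_bigr => v _.
  by rewrite !mxE big_ord1 !mxE.
under eq_bigr do rewrite exchange_big /=.
by rewrite exchange_big.
Qed.

(** * Second order condition at a maximum in one variable *)

(** If [kappa] were positive, [dk] would be positive just to the right of [0], and by the mean value
    theorem [k] would exceed [k 0] there. *)
Lemma second_derivative_at_max (R : realType) (k dk : R -> R) (kappa : R) :
  (\forall t \near (0 : R), is_derive t (1 : R) k (dk t)) -> is_derive (0 : R) 1 dk kappa ->
  (\forall t \near (0 : R), k t <= k 0) -> dk 0 = 0 /\ kappa <= 0.
Proof.
move=> Dk Ddk kmax.
have /nbhs_ballP[e /= e0 He] :
    \forall t \near (0 : R), is_derive t (1 : R) k (dk t) /\ k t <= k 0.
  exact: filterI.
have inball (t : R) : t \in `]-e, e[%R -> ball (0 : R) e t.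
  by rewrite in_itv -ball_normE /= sub0r normrN ltr_norml.
have dk0 : dk 0 = 0.
  have D0 : is_derive (0 : R) 1 k 0.
    apply: (@derive1_at_max _ k (- e) e 0).
    - by rewrite ge0_cp // ltW.
    - by move=> t /inball /He [[]].
    - by rewrite in_itv /= oppr_lt0 e0.
    - by move=> t /inball /He [].
  have D0' := nbhs_singleton Dk.
  by rewrite -(@derive_val _ _ _ _ _ _ _ D0') (@derive_val _ _ _ _ _ _ _ D0).
split=> //; rewrite leNgt; apply/negP => kappa0.
have : (fun h : R => h^-1 *: (dk (h *: (1 : R) + 0) - dk 0)) @ 0^' --> kappa.
  by have [Ddk0 <-] := Ddk; exact: Ddk0.
(* With [kappa] itself as tolerance, the difference quotients of [dk] are positive near [0]. *)
move/cvgrPdist_lt => /(_ _ kappa0) /nbhs_ballP[d /= d0 Hd].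
have dkpos t : 0 < t -> t < d -> 0 < dk t.
  move=> t0 td; have := Hd t; rewrite -ball_normE /= sub0r normrN gtr0_norm //.
  move=> /(_ td (lt0r_neq0 t0)); rewrite dk0 subr0 addr0 [t *: 1]mulr1.
  rewrite ltr_norml => /andP[_]; rewrite ltrBlDr ltrDl.
  by rewrite /GRing.scale /= pmulr_rgt0 // invr_gt0.
have [t [t0 te td]] : exists t : R, [/\ 0 < t, t < e & t < d].
  have me : 0 < Num.min e d by rewrite lt_min e0.
  have : Num.min e d / 2 < Num.min e d by move: me; lra.
  by rewrite lt_min => /andP[? ?]; exists (Num.min e d / 2); split; rewrite ?divr_gt0.
have Dk' x : x \in `[0, t]%R -> is_derive x 1 k (dk x).
  rewrite in_itv /= => /andP[x0 xt].
  have /He[] // : ball (0 : R) e x.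
  by apply: inball; rewrite in_itv /=; apply/andP; split; lra.
have Dk0 (x : R) : x \in `]0, t[%R -> is_derive x 1 k (dk x).
  by move=> xt; apply: Dk'; exact: subset_itv_oo_cc xt.
have kcont : {within `[0, t], continuous k}.
  by apply: derivable_within_continuous => y /Dk' [].
have [c] := MVT t0 Dk0 kcont; rewrite in_itv /= => /andP[c0 ct]; rewrite subr0 => E.
have [_ kt] : is_derive t (1 : R) k (dk t) /\ k t <= k 0.
  by apply: He; apply: inball; rewrite in_itv /=; apply/andP; split; lra.
have : 0 < dk c * t by rewrite mulr_gt0 // dkpos //; lra.
by rewrite -E subr_gt0 ltNge kt.
Qed.

(** * Derivatives along lines and symmetry of the Hessian *)

Section partial_derivatives.
Variables (R : realType) (n : nat).
Local Notation V := 'rV[R]_n.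
Implicit Types (g : V -> R) (x v : V) (i j : 'I_n).

Lemma diff_pdE g x v : differentiable g x ->
  'd g x v = \sum_(i < n) v ord0 i * pd i g x.
Proof.
move=> dg; rewrite {1}[v]row_sum_delta linear_sum; apply: eq_bigr => i _.
by rewrite linearZ /= /pd deriveE.
Qed.

Lemma is_derive_line g x v (t : R) : differentiable g (x + t *: v) ->
  is_derive t 1 (fun s : R => g (x + s *: v))
    (\sum_(i < n) v ord0 i * pd i g (x + t *: v)).
Proof.
move=> dg.
have dl : is_diff t (fun s : R => x + s *: v) (fun s => s *: v).
  have := is_diffD (is_diff_cst x t) (is_diff_scalel t v).
  by rewrite add0r.
have dgl : differentiable (g \o (fun s : R => x + s *: v)) t.
  by apply: differentiable_comp.
apply: DeriveDef; first exact: diff_derivable.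
rewrite deriveE // (diff_comp (f := fun s : R => x + s *: v)) //=.
by rewrite diff_val scale1r diff_pdE.
Qed.

Lemma is_derive_line_pd g x i (t : R) :
  differentiable g (x + t *: delta_mx ord0 i) ->
  is_derive t 1 (fun s : R => g (x + s *: delta_mx ord0 i))
    (pd i g (x + t *: delta_mx ord0 i)).
Proof.
move=> dg; have := is_derive_line dg.
rewrite (bigD1 i) //= mxE !eqxx mul1r big1 ?addr0 // => j ji.
by rewrite mxE eqxx (negbTE ji) mul0r.
Qed.

Lemma MVT_derive_everywhere (f df : R -> R) (t : R) : 0 < t ->
  (forall s : R, is_derive s 1 f (df s)) ->
  exists c : R, [/\ 0 < c, c < t & f t - f 0 = df c * t].
Proof.
move=> t0 Df; have [|c] := MVT t0 (fun s _ => Df s).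
  by apply: derivable_within_continuous => s _; have [] := Df s.
by rewrite in_itv subr0 => /andP[]; exists c.
Qed.

(** Two uses of the mean value theorem: in direction [i] for the increment of [g] along [j], then in
    direction [j] for [pd i g]. *)
Lemma second_difference g i j x (t : R) : C2 g -> 0 < t ->
  exists c d : R, [/\ 0 < c < t, 0 < d < t &
    g (x + t *: delta_mx ord0 j + t *: delta_mx ord0 i) - g (x + t *: delta_mx ord0 i)
    - g (x + t *: delta_mx ord0 j) + g x =
    pd j (pd i g) (x + c *: delta_mx ord0 i + d *: delta_mx ord0 j) * t ^+ 2].
Proof.
move=> [dg [dpg _]] t0; set ei := delta_mx ord0 i; set ej := delta_mx ord0 j.
have [|c [c0 ct E1]] := @MVT_derive_everywhere
    (fun s => g (x + t *: ej + s *: ei) - g (x + s *: ei))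
    (fun s => pd i g (x + t *: ej + s *: ei) - pd i g (x + s *: ei)) t t0.
  by move=> s; apply: is_deriveB; apply: is_derive_line_pd; apply: dg.
have [|d [d0 dt E2]] := @MVT_derive_everywhere
    (fun s => pd i g (x + c *: ei + s *: ej))
    (fun s => pd j (pd i g) (x + c *: ei + s *: ej)) t t0.
  by move=> s; apply: is_derive_line_pd; apply: dpg.
exists c, d; rewrite c0 ct d0 dt; split=> //.
rewrite expr2 mulrA -E2 scale0r addr0 [x + c *: ei + _]addrAC -E1 !scale0r !addr0.
by ring.
Qed.

(** The second difference is symmetric in [i] and [j], so the two mixed derivatives share a value at
    points arbitrarily close to [x]; continuity at [x] concludes. *)
Lemma pdC g i j x : C2 g -> pd j (pd i g) x = pd i (pd j g) x.
Proof.
move=> C2g; apply/eqP; rewrite -subr_eq0 -normr_le0; apply/ler_addgt0Pr => e e0.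
rewrite add0r; have [_ [_ cg]] := C2g.
have e2 : 0 < e / 2 by rewrite divr_gt0.
have near_pd k l : exists2 r : R, 0 < r & forall y, `|y| < r ->
    `|pd l (pd k g) x - pd l (pd k g) (x + y)| < e / 2.
  have := cg k l x => /cvgrPdist_lt /(_ _ e2) /nbhs_ballP[r /= r0 Hr].
  exists r => // y yr; apply: Hr.
  by rewrite -ball_normE /= opprD addrA subrr sub0r normrN.
have [r1 r10 H1] := near_pd i j; have [r2 r20 H2] := near_pd j i.
pose ei : V := delta_mx ord0 i; pose ej : V := delta_mx ord0 j.
have M0 : 0 < `|ei| + `|ej| + 1 by rewrite ltr_wpDl // addr_ge0.
set M := _ + 1 in M0.
(* Both intermediate points lie within [t * M] of [x], so this [t] puts them where each mixed
   derivative varies by less than [e / 2]. *)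
have [t [t0 t1 t2]] : exists t : R, [/\ 0 < t, t * M < r1 & t * M < r2].
  have m0 : 0 < Num.min r1 r2 by rewrite lt_min r10.
  have : Num.min r1 r2 / 2 < Num.min r1 r2 by move: m0; lra.
  rewrite lt_min => /andP[? ?]; exists (Num.min r1 r2 / 2 / M).
  by rewrite divfK ?gt_eqF // !divr_gt0.
have small (c d : R) k l : 0 < c < t -> 0 < d < t -> `|k| + `|l| + 1 = M :> R ->
    `|c *: k + d *: l : V| < t * M.
  move=> /andP[c0 ct] /andP[d0 dt] <-; apply: le_lt_trans (ler_normD _ _) _.
  rewrite !normrZ !gtr0_norm // !mulrDr mulr1 ltr_pwDr // lerD // ler_wpM2r // ltW //.
have [c [d [cP dP E1]]] := second_difference i j x C2g t0.
have [c' [d' [c'P d'P E2]]] := second_difference j i x C2g t0.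
have E : pd j (pd i g) (x + (c *: ei + d *: ej)) = pd i (pd j g) (x + (c' *: ej + d' *: ei)).
  have tn0 : t ^+ 2 != 0 by rewrite expf_neq0 ?gt_eqF.
  rewrite !addrA; apply: (mulIf tn0).
  rewrite -[LHS]E1 -[RHS]E2.
  rewrite [x + t *: delta_mx ord0 j + _]addrAC.
  by ring.
have {}H1 := H1 _ (lt_trans (small c d ei ej cP dP erefl) t1).
have MC : `|ej| + `|ei| + 1 = M by rewrite /M [`|ej| + _]addrC.
have {}H2 := H2 _ (lt_trans (small c' d' ej ei c'P d'P MC) t2).
rewrite E in H1; move: H1 H2.
set p := pd j _ x; set q := pd i _ x; set z := pd i _ _ => H1 H2.
have -> : p - q = (p - z) - (q - z) by ring.
by rewrite [e]splitr; apply: le_trans (ler_normB _ _) (lerD (ltW H1) (ltW H2)).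
Qed.

Lemma is_derive_line2 g x v (t : R) : C2 g ->
  is_derive t 1 (fun s : R => \sum_(i < n) v ord0 i * pd i g (x + s *: v))
    (\sum_(i < n) \sum_(j < n) v ord0 i * v ord0 j * pd j (pd i g) (x + t *: v)).
Proof.
move=> [_ [dpg _]].
have D i : is_derive t 1 (v ord0 i *: (fun s : R => pd i g (x + s *: v)))
    (v ord0 i *: \sum_(j < n) v ord0 j * pd j (pd i g) (x + t *: v)).
  by apply: is_deriveZ; apply: is_derive_line; exact: dpg.
have := is_derive_sum D.
have -> : \sum_(i < n) (v ord0 i *: (fun s : R => pd i g (x + s *: v))) =
    (fun s : R => \sum_(i < n) v ord0 i * pd i g (x + s *: v)).
  by apply/funext => s; rewrite fct_sumE.
congr (is_derive _ _ _ _).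
apply: eq_bigr => i _ /=; rewrite /GRing.scale /= mulr_sumr.
by apply: eq_bigr => j _; rewrite mulrA.
Qed.

End partial_derivatives.

(** * Iterated logarithms and the barrier attached to (F-2') *)

Section iterated_logarithms.
Variable R : realType.
Implicit Types (u : R) (k m : nat).
Local Notation logn_prod k u := (\prod_(0 <= i < k) iter i (@ln R) u).

Lemma iter_ln_ge (k : nat) (A : R) : exists U : R, forall u, U <= u -> A <= iter k (@ln R) u.
Proof.
elim: k A => [|k IH] A; first by exists A.
have [U HU] := IH (expR A); exists U => u /HU Hu.
by rewrite iterS -[A]expRK ler_ln // posrE ?expR_gt0 // (lt_le_trans (expR_gt0 A)).
Qed.

Lemma iter_ln_ge1 (m : nat) :
  exists U : R, forall u, U <= u -> forall k, (k < m)%N -> 1 <= iter k (@ln R) u.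
Proof.
elim: m => [|m [U HU]]; first by exists 0.
have [U' HU'] := iter_ln_ge m 1; exists (Num.max U U') => u.
rewrite ge_max => /andP[/HU Hu /HU' Hu'] k; rewrite ltnS leq_eqVlt.
by case/orP => [/eqP -> //|/Hu].
Qed.

Lemma logn_prod_gt0 k u : (forall i, (i < k)%N -> 1 <= iter i (@ln R) u) ->
  0 < logn_prod k u.
Proof.
elim: k => [|k IH] H; first by rewrite big_geq.
rewrite big_nat_recr //= mulr_gt0 ?IH //; last exact: lt_le_trans (H _ _).
by move=> i ik; apply: H; rewrite ltnS ltnW.
Qed.

Lemma logn_prod_ge k u : (forall i, (i < k.+1)%N -> 1 <= iter i (@ln R) u) ->
  u <= logn_prod k.+1 u.
Proof.
elim: k => [|k IH] H; first by rewrite big_nat1.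
have H' i : (i < k.+1)%N -> 1 <= iter i (@ln R) u by move=> ik; rewrite H // ltnS ltnW.
apply: le_trans (IH H') _; rewrite [leRHS]big_nat_recr //=.
by apply: ler_peMr; [exact/ltW/logn_prod_gt0 | exact: (H k.+1)].
Qed.

Lemma is_derive_iter_ln k u : (forall i, (i < k)%N -> 1 <= iter i (@ln R) u) ->
  is_derive u 1 (iter k (@ln R)) (logn_prod k u)^-1.
Proof.
elim: k => [|k IH] H; first by rewrite big_geq // invr1; exact: is_derive_id.
have lk : 0 < iter k (@ln R) u by exact: lt_le_trans (H _ _).
have D : is_derive u 1 (iter k (@ln R)) (logn_prod k u)^-1.
  by apply: IH => i ik; rewrite H // ltnS ltnW.
have := is_derive1_comp (is_derive1_ln lk) D.
by rewrite big_nat_recr //= invfM mulrC.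
Qed.

(** The last factor has derivative the reciprocal of the product of the others, so it contributes
    exactly [1] to the derivative, and [1] is at most the full product over [u]. *)
Lemma is_derive_logn_prod k u : (forall i, (i < k)%N -> 1 <= iter i (@ln R) u) ->
  exists2 d : R, is_derive u 1 (fun u => logn_prod k u) d &
    0 <= d <= k%:R * logn_prod k u / u.
Proof.
elim: k => [|k IH] H.
  exists 0; last by rewrite mul0r mul0r lexx.
  have -> : (fun u => logn_prod 0 u) = cst 1 by apply/funext => v; rewrite big_geq.
  exact: is_derive_cst.
have H' i : (i < k)%N -> 1 <= iter i (@ln R) u by move=> ik; rewrite H // ltnS ltnW.
have [d Dd /andP[d0 dle]] := IH H'; have Dl := is_derive_iter_ln H'.
have Pk0 := logn_prod_gt0 H'.
have lk : 1 <= iter k (@ln R) u by exact: H.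
have u0 : 0 < u by apply: lt_le_trans (H 0%N _).
exists (1 + iter k (@ln R) u * d).
  have -> : (fun u => logn_prod k.+1 u) = (fun u => logn_prod k u) * iter k (@ln R).
    by apply/funext => v; rewrite big_nat_recr.
  have := is_deriveM Dd Dl; congr (is_derive _ _ _ _).
  by rewrite /GRing.scale /= mulfV ?gt_eqF.
apply/andP; split; first by rewrite addr_ge0 // mulr_ge0 // (le_trans _ lk).
rewrite -natr1 mulrDl mul1r mulrDl addrC lerD //; last first.
  by rewrite ler_pdivlMr // mul1r logn_prod_ge.
rewrite big_nat_recr //= mulrC [_ * (_ * iter _ _ _)]mulrA mulrAC ler_wpM2r //.
exact: le_trans lk.
Qed.

(* The substitution [Psi = - (log^(m+1))^(-eta) / eta], [eta = eps / 2], is bounded above, and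
   the reciprocal [g] of its derivative satisfies [growth = g ^ 2 / u]. *)
Lemma growth_barrier m (eps : R) : 0 < eps ->
  exists (U K : R) (Psi g dg : R -> R), 0 < K /\ forall u, U <= u ->
    [/\ is_derive u 1 Psi (g u)^-1, is_derive u 1 g (dg u), 0 < g u, 0 <= dg u & Psi u <= 0]
    /\ [/\ 0 < growth m eps u, g u * dg u <= K * growth m eps u
         & g u <= K * growth m eps u].
Proof.
move=> eps0; pose eta := eps / 2; have eta0 : 0 < eta by rewrite divr_gt0.
(* The bound [m.+2] also covers the iterate of order [m.+1], which is [L]. *)
have [U HU] := iter_ln_ge1 m.+2.
pose L := iter m.+1 (@ln R); pose P u := logn_prod m.+1 u.
pose g u := P u * L u `^ (1 + eta).
(* The derivative of [g] is at most this constant times [g u / u]: [1 + eta] comes from the power of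
   [L] and [m + 1] from the factors of [P]. *)
exists U, (m.+2%:R + eta), (fun u => - eta^-1 * L u `^ (- eta)), g, (fun u => 'D_1 g u).
have K1 : 1 <= m.+2%:R + eta :> R by rewrite -natr1 -addrA addrCA lerDl addr_ge0 // ltW.
split=> [|u /HU Hu]; first exact: lt_le_trans K1.
have H i : (i < m.+1)%N -> 1 <= iter i (@ln R) u by move=> im; rewrite Hu // ltnS ltnW.
have L1 : 1 <= L u by exact: Hu.
have L0 : 0 < L u by exact: lt_le_trans L1.
have P0 : 0 < P u := logn_prod_gt0 H.
have uP : u <= P u := logn_prod_ge H.
have u1 : 1 <= u by exact: (H 0%N).
have u0 : 0 < u by exact: lt_le_trans u1.
have g0 : 0 < g u by rewrite mulr_gt0 // powR_gt0.
have DL : is_derive u 1 L (P u)^-1 := is_derive_iter_ln H.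
have [d DP /andP[d0 dle]] := is_derive_logn_prod H.
have pow1 : 1 <= L u `^ (1 + eta).
  by rewrite -[leLHS](powRr0 (L u)) ler_powR // addr_ge0 // ltW.
have pow2 : L u `^ eta <= L u `^ (1 + eta) by rewrite ler_powR // lerDr.
have Dg : is_derive u 1 g ((1 + eta) * L u `^ eta + L u `^ (1 + eta) * d).
  have := is_deriveM DP (is_derive1_comp (is_derive1_powR (1 + eta) L0) DL).
  congr (is_derive _ _ _ _); rewrite /GRing.scale /=; congr (_ + _).
  by rewrite mulrC [1 + eta - 1]addrC addKr divfK // gt_eqF.
(* The product in [growth] starts at index 1 while that in [P] starts at 0, hence the division by
   [u]; the powers of [L] match because [2 * eta = eps]. *)
have gE : growth m eps u = g u ^+ 2 / u.
  have PE : P u = u * \prod_(1 <= i < m.+1) iter i (@ln R) u by rewrite /P big_ltn.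
  rewrite /growth /g PE -[iter m.+1 (@ln R) u]/(L u); set Q := \prod_(1 <= i < _) _.
  have -> : L u `^ (2 + eps) = (L u `^ (1 + eta)) ^+ 2.
    rewrite -powR_mulrn ?powR_ge0 // -powRrM; congr (_ `^ _).
    by rewrite /eta; field.
  by field; rewrite gt_eqF.
have dg_ge0 : 0 <= (1 + eta) * L u `^ eta + L u `^ (1 + eta) * d.
  by rewrite addr_ge0 // mulr_ge0 ?powR_ge0 // addr_ge0 // ltW.
have dg_le : (1 + eta) * L u `^ eta + L u `^ (1 + eta) * d <= (m.+2%:R + eta) * (g u / u).
  have -> : (m.+2%:R + eta) * (g u / u) =
      (1 + eta) * (g u / u) + L u `^ (1 + eta) * (m.+1%:R * P u / u).
    by rewrite /g -[m.+2%:R]natr1; field; rewrite gt_eqF.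
  apply: lerD; last by rewrite ler_wpM2l ?powR_ge0.
  apply: ler_wpM2l; first by rewrite addr_ge0 // ltW.
  apply: le_trans pow2 _.
  by rewrite ler_pdivlMr // mulrC ler_wpM2r ?powR_ge0.
have DgE : 'D_1 g u = (1 + eta) * L u `^ eta + L u `^ (1 + eta) * d by case: Dg.
have gV : (g u)^-1 = (P u)^-1 * L u `^ (- (1 + eta)) by rewrite powRN -invfM.
split; split.
- have := is_deriveZ (- eta^-1) (is_derive1_comp (is_derive1_powR (- eta) L0) DL).
  congr (is_derive _ _ _ _); rewrite /GRing.scale /= gV opprD [- eta - 1]addrC.
  by field; rewrite !gt_eqF.
- by rewrite DgE.
- exact: g0.
- by rewrite DgE.
- by rewrite mulNr oppr_le0 mulr_ge0 ?powR_ge0 // invr_ge0 ltW.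
- by rewrite gE divr_gt0 // exprn_gt0.
- rewrite gE DgE expr2 -mulrA mulrCA ler_wpM2l // ltW //.
(* This uses [u <= P u <= g u] and that the constant is at least [1]. *)
- rewrite gE expr2 -mulrA mulrCA; apply: ler_peMr; first exact: ltW.
  rewrite -[leLHS]mulr1; apply: ler_pM => //.
  rewrite ler_pdivlMr // mul1r /g; apply: le_trans uP _.
  by rewrite ler_peMr // ltW.
Qed.

End iterated_logarithms.

(** * Conditions at a penalized maximum along a line *)

(* The comparison function is [ln (rho + 2 t beta + t^2 gamma)], i.e. [ln (1 + |x + t v|^2)]. *)
Lemma line_max_estimate (R : realType) (Psi g dg w dw : R -> R)
    (ddw u1 delta rho beta gamma : R) :
  (forall u, u1 <= u -> is_derive u 1 Psi (g u)^-1) ->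
  (forall u, u1 <= u -> is_derive u 1 g (dg u)) ->
  (forall u, u1 <= u -> 0 < g u) ->
  (forall t : R, is_derive t 1 w (dw t)) -> is_derive (0 : R) 1 dw ddw -> u1 < w 0 -> 0 < rho ->
  (forall t, u1 <= w t -> Psi (w t) - delta * ln (rho + 2 * t * beta + t ^+ 2 * gamma)
     <= Psi (w 0) - delta * ln rho) ->
  dw 0 = g (w 0) * delta * (2 * beta / rho) /\
  ddw <= g (w 0) * delta * (2 * gamma / rho - 4 * beta ^+ 2 / rho ^+ 2)
         + g (w 0) * dg (w 0) * delta ^+ 2 * (4 * beta ^+ 2 / rho ^+ 2).
Proof.
move=> DPsi Dg g0 Dw Ddw w0 rho0 max0.
pose q t := rho + 2 * t * beta + t ^+ 2 * gamma.
pose dq t := 2 * beta + 2 * t * gamma.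
have Dq (t : R) : is_derive t 1 q (dq t).
  have D1 : is_derive t 1 (fun s : R => s) 1 by exact: is_derive_id.
  have := is_deriveD (is_deriveD (is_derive_cst rho t 1) (is_deriveZ (2 * beta) D1))
    (is_deriveZ gamma (is_deriveM D1 D1)).
  have -> : cst rho + (2 * beta) *: (fun s : R => s) +
      gamma *: ((fun s : R => s) * (fun s : R => s)) = q.
    apply/funext => s; rewrite /q.
    transitivity (rho + 2 * beta * s + gamma * (s * s)); first by [].
    by ring.
  by congr (is_derive _ _ _ _); rewrite /GRing.scale /= /dq; ring.
have Ddq (t : R) : is_derive t 1 dq (2 * gamma).
  have D1 : is_derive t 1 (fun s : R => s) 1 by exact: is_derive_id.
  have := is_deriveD (is_derive_cst (2 * beta) t 1) (is_deriveZ (2 * gamma) D1).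
  have -> : cst (2 * beta) + (2 * gamma) *: (fun s : R => s) = dq.
    apply/funext => s; rewrite /dq.
    transitivity (2 * beta + 2 * gamma * s); first by [].
    by ring.
  by congr (is_derive _ _ _ _); rewrite /GRing.scale /=; ring.
have q0 : q 0 = rho by rewrite /q; ring.
have dq0 : dq 0 = 2 * beta by rewrite /dq; ring.
have cont (h dh : R -> R) : (forall t : R, is_derive t 1 h (dh t)) -> continuous h.
  by move=> Dh t; apply/differentiable_continuous/derivable1_diffP; case: (Dh t).
have near_w : \forall t \near (0 : R), u1 < w t.
  exact: (cvgr_gt (w 0) (cont _ _ Dw 0)).
have near_q : \forall t \near (0 : R), 0 < q t.
  by apply: (cvgr_gt (q 0) (cont _ _ Dq 0)); rewrite q0.
have Dk : \forall t \near (0 : R), is_derive t (1 : R)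
    (fun t => Psi (w t) - delta * ln (q t)) ((g (w t))^-1 * dw t - delta * ((q t)^-1 * dq t)).
  near=> t.
  have wt : u1 <= w t by apply: ltW; near: t.
  have qt : 0 < q t by near: t.
  apply: is_deriveB; first exact: is_derive1_comp (DPsi _ wt) (Dw t).
  by apply: is_deriveZ; exact: is_derive1_comp (is_derive1_ln qt) (Dq t).
pose dd := (g (w 0))^-1 * ddw - dw 0 * (dg (w 0) * dw 0 / g (w 0) ^+ 2)
   - delta * (2 * gamma / rho - 4 * beta ^+ 2 / rho ^+ 2).
have g00 := g0 _ (ltW w0).
have Ddk : is_derive (0 : R) 1
    (fun t => (g (w t))^-1 * dw t - delta * ((q t)^-1 * dq t)) dd.
  have D1 := is_derive1_comp (Dg _ (ltW w0)) (Dw 0).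
  have D2 := is_deriveV (lt0r_neq0 g00) D1.
  have q00 : q 0 != 0 by rewrite q0 gt_eqF.
  have D3 := is_deriveV q00 (Dq 0).
  have := is_deriveB (is_deriveM D2 Ddw) (is_deriveZ delta (is_deriveM D3 (Ddq 0))).
  congr (is_derive _ _ _ _); rewrite /GRing.scale /= q0 dq0 /dd.
  by field; rewrite !gt_eqF.
have [|dk0 ddk0] := second_derivative_at_max Dk Ddk.
  near=> t; rewrite [q 0]q0; apply: max0; apply: ltW; near: t; exact: near_w.
have dw0 : dw 0 = g (w 0) * delta * (2 * beta / rho).
  move: dk0; rewrite q0 dq0 => /eqP; rewrite subr_eq0 => /eqP E.
  have -> : dw 0 = g (w 0) * ((g (w 0))^-1 * dw 0) by rewrite mulrA mulfV ?mul1r // gt_eqF.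
  by rewrite E; field; rewrite gt_eqF.
(* The first order condition eliminates [dw 0] from the second order one, which is then multiplied
   by [g (w 0) > 0]. *)
split=> //; move: ddk0; rewrite /dd dw0.
rewrite -(pmulr_rle0 _ g00); set X := (X in X <= 0).
have -> : X = ddw - (g (w 0) * delta * (2 * gamma / rho - 4 * beta ^+ 2 / rho ^+ 2)
         + g (w 0) * dg (w 0) * delta ^+ 2 * (4 * beta ^+ 2 / rho ^+ 2)).
  by rewrite /X; field; rewrite !gt_eqF.
by rewrite subr_le0.
Unshelve. all: by end_near. Qed.

(** * Euclidean norm and existence of penalized maxima *)

Section euclidean_norm.
Variables (R : realType) (n : nat).
Local Notation V := 'rV[R]_n.
Implicit Types (x y v : V).

Lemma sqr_enorm x : enorm x ^+ 2 = \sum_(i < n) x ord0 i ^+ 2.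
Proof. by rewrite sqr_sqrtr // sumr_ge0 // => i _; exact: sqr_ge0. Qed.

Lemma sqr_enorm_line x v (t : R) :
  enorm (x + t *: v) ^+ 2 =
  enorm x ^+ 2 + 2 * t * (\sum_(i < n) x ord0 i * v ord0 i) + t ^+ 2 * enorm v ^+ 2.
Proof.
rewrite !sqr_enorm !mulr_sumr -!big_split /=; apply: eq_bigr => i _.
by rewrite !mxE; ring.
Qed.

Lemma sqr_enorm_delta (i : 'I_n) : enorm (delta_mx ord0 i : V) ^+ 2 = 1.
Proof.
rewrite sqr_enorm (bigD1 i) //= mxE !eqxx expr1n big1 ?addr0 // => j ji.
by rewrite mxE eqxx (negbTE ji) expr0n.
Qed.

Lemma sum_mul_delta (c : 'I_n -> R) (i : 'I_n) :
  \sum_(j < n) c j * (delta_mx ord0 i : V) ord0 j = c i.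
Proof.
rewrite (bigD1 i) //= mxE !eqxx mulr1 big1 ?addr0 // => j ji.
by rewrite mxE eqxx (negbTE ji) mulr0.
Qed.

Lemma continuous_sqr_enorm : continuous (fun x => enorm x ^+ 2).
Proof.
under eq_fun do rewrite sqr_enorm.
apply: continuous_big => [|i _ x]; first exact: add_continuous.
by have c := @coord_continuous R 1 n ord0 i x; exact: (cvgM c c).
Qed.

Lemma compact_sqr_enorm_le (M : R) : compact [set x : V | enorm x ^+ 2 <= M].
Proof.
apply: bounded_closed_compact; last first.
  by apply: (@closed_comp _ _ (fun x => enorm x ^+ 2) [set r | r <= M]);
     [move=> x _; exact: continuous_sqr_enorm | exact: closed_le].
exists (M + 1); split=> [|r Mr x /= xM]; first exact: num_real.
rewrite [leLHS]/Num.norm /= mx_normrE; apply/bigmax_leP; split=> [|[i j] _ /=].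
  by apply: le_trans (ltW Mr); rewrite addr_ge0 // (le_trans _ xM) // sqr_ge0.
apply: le_trans (ltW Mr); rewrite (ord1 i).
have : x ord0 j ^+ 2 <= M.
  apply: le_trans xM; rewrite sqr_enorm (bigD1 j) //= lerDl sumr_ge0 // => k _.
  exact: sqr_ge0.
rewrite -real_normK ?num_real //; move: (`|_|) => z.
by have := sqr_ge0 (z - 1); nra.
Qed.

(** The logarithmic penalty tends to infinity while [Q] stays below [B], so a maximum over a large
    closed ball, which is compact, is global. *)
Lemma penalized_max (Q : V -> R) (B delta : R) : 0 < delta -> continuous Q ->
  (forall x, Q x <= B) ->
  exists xh, forall y, Q y - delta * ln (1 + enorm y ^+ 2)
                       <= Q xh - delta * ln (1 + enorm xh ^+ 2).
Proof.
move=> delta0 cQ QB.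
have pos1 y : 0 < 1 + enorm y ^+ 2 by rewrite ltr_pwDl // sqr_ge0.
(* Where [enorm y ^+ 2 > M] the penalty is at least [B - Q 0], so the penalized value does not
   exceed the one at the origin. *)
pose M := expR ((B - Q 0) / delta).
have n0 : enorm (0 : V) ^+ 2 = 0.
  by rewrite sqr_enorm big1 // => i _; rewrite mxE expr0n.
have A0 : [set x : V | enorm x ^+ 2 <= M] 0 by rewrite /= n0 expR_ge0.
have cln : continuous (fun y : V => ln (1 + enorm y ^+ 2)).
  move=> x; have c1 : {for x, continuous (fun y : V => 1 + enorm y ^+ 2)}.
    exact: (cvgD (cvg_cst (1 : R)) (@continuous_sqr_enorm x)).
  exact: (continuous_comp c1 (continuous_ln (pos1 x))).
have cf : continuous (fun y => Q y - delta * ln (1 + enorm y ^+ 2)).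
  by move=> x; exact: (cvgB (cQ x) (cvgM (cvg_cst delta) (cln x))).
have [||xh _ xhmax] := @EVT_max_rV R n
    (fun y => Q y - delta * ln (1 + enorm y ^+ 2)) _ _ (@compact_sqr_enorm_le M).
- by exists 0.
- by apply: continuous_subspaceT.
exists xh => y; have [yM|My] := leP (enorm y ^+ 2) M.
  by apply: xhmax; rewrite inE.
have := xhmax 0; rewrite inE n0 addr0 ln1 mulr0 subr0 => /(_ A0); apply: le_trans.
have : (B - Q 0) / delta <= ln (1 + enorm y ^+ 2).
  rewrite -[leLHS]expRK ler_ln ?posrE ?expR_gt0 //.
  by apply: le_trans (ltW My) _; rewrite lerDr.
rewrite ler_pdivrMr // mulrC => H.
by have := QB y; move: H; lra.
Qed.

End euclidean_norm.

(** * Comparison argument for [L] under (L-1) *)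

Section barrier.
Variables (R : realType) (n : nat).
Local Notation V := 'rV[R]_n.
Variables (a : 'I_n -> 'I_n -> V -> R) (b : 'I_n -> V -> R) (C : R).
Hypothesis ell : elliptic a.
Hypothesis C0 : 0 < C.
Hypothesis a_le : forall x (nu : V),
  \sum_(i < n) \sum_(j < n) a i j x * nu ord0 i * nu ord0 j
  <= C * enorm nu ^+ 2 * (1 + enorm x ^+ 2).
Hypothesis b_le : forall x, enorm (\row_(i < n) b i x) <= C * (1 + enorm x).

Lemma diag_sum_le x : \sum_(i < n) a i i x <= n%:R * C * (1 + enorm x ^+ 2).
Proof.
have -> : n%:R * C * (1 + enorm x ^+ 2) = \sum_(i < n) C * (1 + enorm x ^+ 2).
  by rewrite sumr_const card_ord -[RHS]mulr_natl mulrA.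
apply: ler_sum => i _; have := a_le x (delta_mx ord0 i).
rewrite sqr_enorm_delta mulr1; congr (_ <= _).
under eq_bigr => j _ do rewrite (sum_mul_delta (fun k => a j k x * _)).
exact: (sum_mul_delta (fun j => a j i x)).
Qed.

(** Termwise [2 b x <= b^2 + x^2], then the linear growth of [b] squared. *)
Lemma drift_sum_le x :
  \sum_(i < n) b i x * (2 * x ord0 i) <= (2 * C ^+ 2 + 1) * (1 + enorm x ^+ 2).
Proof.
have b2 : \sum_(i < n) b i x ^+ 2 <= 2 * C ^+ 2 * (1 + enorm x ^+ 2).
  have -> : \sum_(i < n) b i x ^+ 2 = enorm (\row_(i < n) b i x) ^+ 2.
    by rewrite sqr_enorm; apply: eq_bigr => i _; rewrite mxE.
  have r0 : 0 <= enorm x by exact: sqrtr_ge0.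
  have : enorm (\row_(i < n) b i x) ^+ 2 <= (C * (1 + enorm x)) ^+ 2.
    by rewrite ler_sqr ?nnegrE ?b_le // ?sqrtr_ge0 // mulr_ge0 ?addr_ge0 // ltW.
  move/le_trans; apply.
  have -> : 2 * C ^+ 2 * (1 + enorm x ^+ 2) = C ^+ 2 * (2 * (1 + enorm x ^+ 2)) by ring.
  rewrite exprMn; apply: ler_wpM2l; first exact: sqr_ge0.
  by have := sqr_ge0 (enorm x - 1); nra.
have : \sum_(i < n) b i x * (2 * x ord0 i) <= \sum_(i < n) (b i x ^+ 2 + x ord0 i ^+ 2).
  by apply: ler_sum => i _; have := sqr_ge0 (b i x - x ord0 i); nra.
move/le_trans; apply; rewrite big_split /= -sqr_enorm.
by rewrite mulrDl mul1r lerD // lerDr.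
Qed.

(** The directional bounds are summed over the vectors [v] of the decomposition of [a] at [x]: the
    squares of [enorm v] add up to the trace of [a], those of [beta] to its form at [x], and (L-1)
    bounds both. Coordinate directions give the gradient for the drift term. *)
Lemma Lop_le (W : V -> R) (x : V) (c1 c2 : R) : C2 W -> 0 <= c1 -> 0 <= c2 ->
  (forall v : V, let beta := \sum_(i < n) x ord0 i * v ord0 i in
    \sum_(i < n) v ord0 i * pd i W x = c1 * (2 * beta / (1 + enorm x ^+ 2)) /\
    \sum_(i < n) \sum_(j < n) v ord0 i * v ord0 j * pd j (pd i W) x <=
      c1 * (2 * enorm v ^+ 2 / (1 + enorm x ^+ 2) - 4 * beta ^+ 2 / (1 + enorm x ^+ 2) ^+ 2)
      + c2 * (4 * beta ^+ 2 / (1 + enorm x ^+ 2) ^+ 2)) ->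
  Lop a b W x <= c1 * (2 * n%:R * C + 2 * C ^+ 2 + 1) + c2 * (4 * C).
Proof.
move=> C2W c10 c20 H; set rho := 1 + enorm x ^+ 2 in H *.
have rho0 : 0 < rho by rewrite ltr_pwDl // sqr_ge0.
have [s Hs] := posdef_form_rank1 (ell x).
pose beta (v : V) := \sum_(i < n) x ord0 i * v ord0 i.
have sum_gamma : \sum_(v <- s) enorm v ^+ 2 <= n%:R * C * rho.
  apply: le_trans (diag_sum_le x).
  have -> : \sum_(i < n) a i i x = \sum_(i < n) \sum_(j < n) a i j x * (i == j)%:R.
    apply: eq_bigr => i _; rewrite (bigD1 i) //= eqxx mulr1 big1 ?addr0 // => j ji.
    by rewrite eq_sym (negbTE ji) mulr0.
  rewrite Hs; last by move=> i j; rewrite eq_sym.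
  apply: ler_sum => v _; rewrite sqr_enorm; apply: ler_sum => i _.
  rewrite (bigD1 i) //= eqxx mulr1 big1 ?addr0 // => j ji.
  by rewrite eq_sym (negbTE ji) mulr0.
have sum_beta : \sum_(v <- s) beta v ^+ 2 <= C * rho ^+ 2.
  have -> : \sum_(v <- s) beta v ^+ 2 =
      \sum_(i < n) \sum_(j < n) a i j x * x ord0 i * x ord0 j.
    under [RHS]eq_bigr do under eq_bigr do rewrite -mulrA.
    rewrite (Hs (fun i j => x ord0 i * x ord0 j)); last by move=> i j; rewrite mulrC.
    apply: eq_bigr => v _; rewrite expr2 /beta mulr_suml; apply: eq_bigr => i _.
    by rewrite mulr_sumr; apply: eq_bigr => j _; ring.
  apply: le_trans (a_le x x) _; rewrite -/rho [rho ^+ 2]expr2 -[leLHS]mulrA.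
  apply: ler_wpM2l; first exact: ltW.
  by apply: ler_wpM2r; [exact: ltW | rewrite lerDr].
have sum_a : \sum_(i < n) \sum_(j < n) a i j x * pd j (pd i W) x <=
    c1 * (2 * n%:R * C) + c2 * (4 * C).
  rewrite (Hs (fun i j => pd j (pd i W) x)); last by move=> i j; exact: pdC.
  apply: (@le_trans _ _ (\sum_(v <- s)
      (c1 * 2 / rho * enorm v ^+ 2 + c2 * 4 / rho ^+ 2 * beta v ^+ 2))).
    apply: ler_sum => v _; have [_] := H v; rewrite -/(beta v) => /le_trans; apply.
    (* The negative term with coefficient [c1] has the favourable sign and is dropped. *)
    have : 0 <= c1 * (4 * beta v ^+ 2 / rho ^+ 2).
      apply: mulr_ge0 => //; apply: divr_ge0; last exact: sqr_ge0.
      by apply: mulr_ge0 => //; exact: sqr_ge0.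
    set X := beta v ^+ 2; set Y := enorm v ^+ 2 => Z0.
    have -> : c1 * 2 / rho * Y + c2 * 4 / rho ^+ 2 * X =
      c1 * (2 * Y / rho - 4 * X / rho ^+ 2) + c2 * (4 * X / rho ^+ 2)
      + c1 * (4 * X / rho ^+ 2) by field; rewrite gt_eqF.
    by rewrite lerDl.
  rewrite big_split /= -!mulr_sumr; apply: lerD.
    have -> : c1 * (2 * n%:R * C) = c1 * 2 / rho * (n%:R * C * rho).
      by field; rewrite gt_eqF.
    by apply: ler_wpM2l => //; apply: divr_ge0; [exact: mulr_ge0 | exact: ltW].
  have -> : c2 * (4 * C) = c2 * 4 / rho ^+ 2 * (C * rho ^+ 2).
    by field; rewrite gt_eqF.
  by apply: ler_wpM2l => //; apply: divr_ge0; [exact: mulr_ge0 | exact: sqr_ge0].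
have pdE i : pd i W x = c1 * (2 * x ord0 i / rho).
  have [+ _] := H (delta_mx ord0 i); rewrite (sum_mul_delta (fun j => x ord0 j)) => <-.
  rewrite -(sum_mul_delta (fun j => pd j W x) i).
  by apply: eq_bigr => j _; rewrite mulrC.
have sum_b : \sum_(i < n) b i x * pd i W x <= c1 * (2 * C ^+ 2 + 1).
  have -> : \sum_(i < n) b i x * pd i W x =
      c1 / rho * \sum_(i < n) b i x * (2 * x ord0 i).
    by rewrite mulr_sumr; apply: eq_bigr => i _; rewrite pdE; field; rewrite gt_eqF.
  have -> : c1 * (2 * C ^+ 2 + 1) = c1 / rho * ((2 * C ^+ 2 + 1) * rho).
    by field; rewrite gt_eqF.
  by apply: ler_wpM2l; [apply: divr_ge0 => //; exact: ltW | exact: drift_sum_le].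
by rewrite /Lop; move: (lerD sum_a sum_b); lra.
Qed.

(* At a maximum of [Psi (W) - delta ln (1 + |x|^2)] the two bounds on [g] give [Lop W < Lop W]. *)
Lemma le_of_barrier (W Psi g dg : _ -> R) (u1 K B : R) : C2 W ->
  (forall u, u1 <= u -> is_derive u 1 Psi (g u)^-1) ->
  (forall u, u1 <= u -> is_derive u 1 g (dg u)) ->
  (forall u, u1 <= u -> 0 < g u) -> (forall u, u1 <= u -> 0 <= dg u) -> 0 < K ->
  (forall x, u1 <= W x -> Psi (W x) <= B) ->
  (forall x, u1 <= W x -> g (W x) * dg (W x) <= K * Lop a b W x) ->
  (forall x, u1 <= W x -> g (W x) <= K * Lop a b W x) ->
  forall x : V, W x <= u1.
Proof.
move=> C2W DPsi Dg g0 dg0 K0 PsiB gdgK gK x0; rewrite leNgt; apply/negP => Wx0.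
have [dW _] := C2W.
have cW : continuous W by move=> x; exact/differentiable_continuous/dW.
have cPsi u : u1 <= u -> {for u, continuous Psi}.
  by move=> /DPsi [DP _]; exact/differentiable_continuous/derivable1_diffP.
have Psi_lt : Psi u1 < Psi (W x0).
  have D u : u \in `]u1, W x0[%R -> is_derive u 1 Psi (g u)^-1.
    by rewrite in_itv /= => /andP[/ltW uu _]; exact: DPsi.
  have cP : {within `[u1, W x0], continuous Psi}.
    apply: derivable_within_continuous => u; rewrite in_itv /= => /andP[uu _].
    by have [] := DPsi _ uu.
  have [c] := MVT Wx0 D cP; rewrite in_itv /= => /andP[/ltW cu _] E; rewrite -subr_gt0 E mulr_gt0 ?subr_gt0 //.
  by rewrite invr_gt0 g0.
pose C1 := 2 * n%:R * C + 2 * C ^+ 2 + 1.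
have C10 : 0 < C1 by rewrite ltr_wpDl // addr_ge0 // !mulr_ge0 // ltW.
have phi_ge0 (x : V) : 0 <= ln (1 + enorm x ^+ 2).
  by apply: ln_ge0; rewrite lerDl sqr_ge0.
have pos1 (y : V) : 0 < 1 + enorm y ^+ 2 by rewrite ltr_pwDl // sqr_ge0.
(* The second condition allows [delta ^+ 2 <= delta], the third yields the final contradiction, and
   the last keeps the maximum point in the region [W > u1]. *)
have [delta [delta0 delta1 deltaK deltaPsi]] : exists delta : R, [/\ 0 < delta, delta <= 1,
    delta * (K * (C1 + 4 * C)) < 1 &
    delta * ln (1 + enorm x0 ^+ 2) < Psi (W x0) - Psi u1].
  have KC : 0 < K * (C1 + 4 * C) by rewrite mulr_gt0 // addr_gt0 // mulr_gt0.
  have phi0 := phi_ge0 x0; set ph := ln _ in phi0 *.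
  have dPsi : 0 < Psi (W x0) - Psi u1 by rewrite subr_gt0.
  set D := _ - _ in dPsi *; set k := K * _ in KC *.
  pose d1 := (2 * k)^-1; pose d2 := D / (ph + 1).
  have ph1 : 0 < ph + 1 by rewrite ltr_wpDl.
  have d10 : 0 < d1 by rewrite invr_gt0 mulr_gt0.
  have d20 : 0 < d2 by rewrite divr_gt0.
  exists (Num.min 1 (Num.min d1 d2)); split.
  - by rewrite !lt_min ltr01 d10.
  - by rewrite ge_min lexx.
  - have : Num.min 1 (Num.min d1 d2) <= d1 by rewrite !ge_min lexx /= orbT.
    move/(ler_wpM2r (ltW KC))/le_lt_trans; apply.
    have -> : d1 * k = 2^-1 by rewrite /d1; field; rewrite gt_eqF.
    by rewrite invf_lt1 // ltr1n.
  - have : Num.min 1 (Num.min d1 d2) <= d2 by rewrite !ge_min lexx /= !orbT.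
    move/(ler_wpM2r phi0)/le_lt_trans; apply.
    rewrite /d2 mulrAC ltr_pdivrMr //; rewrite ltr_pM2l //; by rewrite ltrDl.
(* Since [Psi] is controlled only from [u1] on, [W] is truncated below at [u1], which makes [Q]
   continuous everywhere. *)
pose Q x := Psi (Num.max (W x) u1).
have maxE (x : V) : u1 <= W x -> Q x = Psi (W x) by rewrite /Q => /max_idPl ->.
have [||xh xhmax] := @penalized_max R n Q (Num.max B (Psi u1)) delta delta0.
- move=> x; apply: (@continuous_comp _ _ _ (fun y => Num.max (W y) u1) Psi).
    exact: (continuous_max (cW x) (@cst_continuous _ _ u1 x)).
  by apply: cPsi; rewrite le_max lexx orbT.
- move=> x; rewrite /Q; have [Wx|Wx] := leP u1 (W x).
    by rewrite le_max PsiB.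
  by rewrite le_max lexx orbT.
(* Otherwise [Q xh = Psi u1], and the penalized value at [x0] would be larger by the choice of
   [delta]. *)
have Wxh : u1 < W xh.
  rewrite ltNge; apply/negP => Wle.
  have := xhmax x0; rewrite (maxE _ (ltW Wx0)) /Q (max_idPr Wle).
  have := mulr_ge0 (ltW delta0) (phi_ge0 xh).
  by move: deltaPsi; lra.
have gh := g0 _ (ltW Wxh); have dgh := dg0 _ (ltW Wxh).
have : Lop a b W xh <= g (W xh) * delta * C1 + g (W xh) * dg (W xh) * delta ^+ 2 * (4 * C).
  apply: Lop_le => //.
  - by apply: mulr_ge0; exact: ltW.
  - by apply: mulr_ge0; [apply: mulr_ge0 => //; exact: ltW | exact: sqr_ge0].
  move=> v beta.
  have lineE (t : R) : 1 + enorm (xh + t *: v) ^+ 2 =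
      1 + enorm xh ^+ 2 + 2 * t * beta + t ^+ 2 * enorm v ^+ 2.
    by rewrite sqr_enorm_line !addrA.
  have l0 : xh + 0 *: v = xh by rewrite scale0r addr0.
  have Dl (t : R) := is_derive_line (dW (xh + t *: v)).
  have := line_max_estimate DPsi Dg g0 Dl (is_derive_line2 xh v 0 C2W) _ (pos1 xh).
  move=> /(_ delta beta (enorm v ^+ 2)).
  rewrite !l0 => /(_ Wxh); apply => t Wt.
  by have := xhmax (xh + t *: v); rewrite (maxE _ Wt) (maxE _ (ltW Wxh)) lineE.
have := gdgK _ (ltW Wxh); have := gK _ (ltW Wxh).
set l := Lop a b W xh => gl gdgl.
have l0 : 0 < l by rewrite -(pmulr_rgt0 _ K0) (lt_le_trans gh).
(* As [g] and [g * dg] are at most [K * l], the upper bound for [l] is at most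
   [delta * (K * (C1 + 4 * C)) * l < l]. *)
apply/negP; rewrite -ltNge.
apply: (@le_lt_trans _ _ (delta * (K * (C1 + 4 * C)) * l)); last first.
  by rewrite gtr_pMl.
have -> : delta * (K * (C1 + 4 * C)) * l = K * l * (delta * C1) + K * l * (delta * (4 * C)).
  by ring.
rewrite -[g _ * delta * C1]mulrA -[_ * delta ^+ 2 * _]mulrA; apply: lerD.
  by apply: ler_wpM2r => //; rewrite mulr_ge0 // ltW.
have C40 : 0 <= 4 * C by rewrite mulr_ge0 // ltW.
apply: ler_pM => //.
- by apply: mulr_ge0 => //; exact: ltW.
- by apply: mulr_ge0 => //; exact: sqr_ge0.
apply: ler_wpM2r => //; rewrite expr2 -[leRHS]mulr1.
by apply: ler_wpM2l => //; exact: ltW.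
Qed.

End barrier.

(** * Vanishing of stationary solutions *)

Lemma loc_lip0_within_continuous (R : realType) (h : R -> R) (u v : R) :
  loc_lip0 h -> 0 < u -> {within `[u, v], continuous h}.
Proof.
move=> lip u0; apply/subspace_continuousP => t; rewrite /= in_itv /= => /andP[ut tv].
have t0 : 0 <= t by exact: le_trans (ltW u0) ut.
have v0 : 0 < v by exact: lt_le_trans u0 (le_trans ut tv).
have [K HK] := lip v v0.
apply/cvgrPdist_lt => e e0.
(* The Lipschitz constant [K] carries no sign, so a positive majorant is used. *)
have K1 : 0 < `|K| + 1 by rewrite ltr_wpDl.
rewrite /prop_near1 /within /=; apply/nbhs_ballP; exists (e / (`|K| + 1)) => /=.
  by rewrite divr_gt0.
move=> s; rewrite -ball_normE /= ltr_pdivlMr // => ts; rewrite in_itv /= => /andP[us sv].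
have s0 : 0 <= s by exact: le_trans (ltW u0) us.
apply: le_lt_trans ts; apply: le_trans (HK _ _ _ _) _; rewrite ?t0 ?s0 //.
by rewrite mulrC ler_wpM2l // (le_trans (ler_norm K)) // lerDl.
Qed.

(** A negative supremum of a nonempty set of reals is finite, so [fine] returns its true value and
    not the default [0]. *)
Lemma Fsup_bounds (R : realType) (n : nat) (f : 'rV[R]_n -> R -> R) (u : R) :
  (Fsup f u < 0)%E -> fine (Fsup f u) < 0 /\ forall x, f x u <= fine (Fsup f u).
Proof.
move=> F0.
have ub x : ((f x u)%:E <= Fsup f u)%E by apply: ereal_sup_ubound; exists x.
have : Fsup f u \is a fin_num.
  by rewrite fin_numE gt_eqF ?lt_eqF // ?(lt_trans F0) // (lt_le_trans _ (ub 0)) // ltNyr.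
move=> /fineK FE; split; first by rewrite -lte_fin FE.
by move=> x; rewrite -lee_fin FE.
Qed.

(** Common core of both halves of the theorem, each of which supplies [F < 0] on the positive
    reals. *)
Lemma stationary_sol_eq0 (R : realType) (n : nat)
    (a : 'I_n -> 'I_n -> 'rV[R]_n -> R) (b : 'I_n -> 'rV[R]_n -> R)
    (f : 'rV[R]_n -> R -> R) (W : 'rV[R]_n -> R) :
  elliptic a -> L1 a b -> (forall u : R, 0 < u -> (Fsup f u < 0)%E) ->
  F2' f -> loc_lip0 (fun u => fine (Fsup f u)) ->
  stationary_sol a b f W -> W = (fun _ => 0).
Proof.
move=> ell [C [C0 [a_le b_le]]] F0 [m [eps [eps0 Fcvg]]] Flip [C2W [W0 eqW]].
have LopF x : 0 < W x -> - fine (Fsup f (W x)) <= Lop a b W x.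
  move=> /F0 /Fsup_bounds [_ /(_ x)]; have := eqW x; lra.
have [M WM] : exists M : R, forall x, W x <= M.
  have [U [K [Psi [g [dg [K0 H]]]]]] := growth_barrier m eps0.
  (* The level [-1] turns (F-2') into [growth <= - F] beyond [U2]; as this holds only strictly
     beyond [U2], [u1] is taken at least [U2 + 1]. *)
  have := Fcvg => /cvgrNyPle /(_ (-1)) [U2 [_ HU2]].
  pose u1 := Num.max U (Num.max (U2 + 1) 1); exists u1.
  have uU u : u1 <= u -> [/\ U <= u, U2 < u & 0 < u].
    rewrite !ge_max => /and3P[-> U2u u1u]; split=> //; last exact: lt_le_trans u1u.
    by apply: lt_le_trans U2u; rewrite ltrDl.
  have grL x : u1 <= W x -> growth m eps (W x) <= Lop a b W x.
    move=> /uU [/H [_ [gr0 _ _]] /HU2 /= Fle Wx0].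
    by apply: le_trans (LopF x Wx0); move: Fle; rewrite ler_pdivrMr // mulN1r; lra.
  apply: (@le_of_barrier R n a b C ell C0 a_le b_le W Psi g dg u1 K 0 C2W) => //.
  - by move=> u /uU [/H [[]]].
  - by move=> u /uU [/H [[]]].
  - by move=> u /uU [/H [[]]].
  - by move=> u /uU [/H [[]]].
  - by move=> x /uU [/H [[]]].
  - move=> x Wx; have [/H [_ [_ gdg _]] _ _] := uU _ Wx.
    by apply: le_trans gdg _; apply: ler_wpM2l; [exact: ltW | exact: grL].
  - move=> x Wx; have [/H [_ [_ _ gle]] _ _] := uU _ Wx.
    by apply: le_trans gle _; apply: ler_wpM2l; [exact: ltW | exact: grL].
apply/funext => x0; apply/eqP; rewrite eq_le W0 andbT; apply/ler_addgt0Pr => e e0.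
rewrite add0r; have [Me|eM] := leP M e; first exact: le_trans (WM x0) Me.
(* On [[e, M]], which contains every value of [W] above [e], the continuous function [F] has a
   negative maximum, so [- F] has a positive lower bound [h]. *)
have [c] := EVT_max (ltW eM) (@loc_lip0_within_continuous _ _ e M Flip e0).
rewrite in_itv /= => /andP[ec _] cmax.
have [Fc _] := Fsup_bounds (F0 c (lt_le_trans e0 ec)).
set h := - fine (Fsup f c).
have h0 : 0 < h by rewrite oppr_gt0.
have hL x : e <= W x -> h <= Lop a b W x.
  move=> ex; have Wx0 := lt_le_trans e0 ex; apply: le_trans (LopF x Wx0).
  by rewrite lerN2; apply: cmax; rewrite in_itv /= ex WM.
apply: (@le_of_barrier R n a b C ell C0 a_le b_le W id (cst 1) (cst 0) e h^-1 M C2W) => //.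
- by move=> u _; rewrite invr1; exact: is_derive_id.
- by rewrite invr_gt0.
- move=> x ex; rewrite mulr0 mulr_ge0 // ?invr_ge0; first exact: ltW.
  exact: le_trans (ltW h0) (hL x ex).
- by move=> x ex; rewrite ler_pdivlMl // mulr1; exact: hL.
Qed.

Theorem theorem5 (R : realType) (n : nat) (alpha : R)
  (a : 'I_n -> 'I_n -> 'rV[R]_n -> R) (b : 'I_n -> 'rV[R]_n -> R)
  (f : 'rV[R]_n -> R -> R) :
  0 < alpha < 1 ->
  (forall i j, loc_holder alpha (a i j)) ->
  (forall i, loc_holder alpha (b i)) ->
  elliptic a ->
  loc_lip_xu f ->
  (* main statement *)
  (F1' f -> F2' f -> F3 f -> F4a f -> L1 a b ->
   (forall u : R, 0 < u -> (Gsup f u < 0)%E) ->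
   forall W : 'rV[R]_n -> R, stationary_sol a b f W -> W = (fun _ => 0))
  /\
  (* the "in particular" part *)
  ((forall x (u v t : R), 0 <= u -> 0 <= v -> 0 <= t <= 1 ->
      t * f x u + (1 - t) * f x v <= f x (t * u + (1 - t) * v)) ->
   (forall u : R, 0 < u -> (Fsup f u < 0)%E) ->
   F2' f -> F3 f -> L1 a b ->
   forall W : 'rV[R]_n -> R, stationary_sol a b f W -> W = (fun _ => 0)).
Proof.
move=> _ _ _ ell _; split=> [_ HF2 [f0 Flip] _ HL1 G0 W | _ F0 HF2 [_ Flip] HL1 W];
  apply: stationary_sol_eq0 => // u u0.
(* Taking [v = u] in the definition of [G] and using [f x 0 = 0] gives [F u <= G u < 0]. *)
apply: le_lt_trans (G0 u u0); apply: ereal_sup_le => _ [x _ <-].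
by exists x => //; exists u => //=; rewrite subrr f0 subr0.
Qed.
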